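(* Let $1<p<\infty$ and $1<q\le p$. Let $u,v:\mathbb{R}^N\to\mathbb{R}$ be two measurable functions with $v\ge 0$ and $u>0$. Then, for all $x,y\in\mathbb{R}^N$, \[ |u(x)-u(y)|^{p-2}\, (u(x)-u(y))\, \left[\frac{v(x)^q}{u(x)^{q-1}}-\frac{v(y)^q}{u(y)^{q-1}}\right]\le|v(x)-v(y)|^q\,|u(x)-u(y)|^{p-q}. \]
   Context: The expression $|a|^{p-2}a$ is understood to be $0$ when $a=0$ (also for $p<2$), and the factor $|u(x)-u(y)|^{p-q}$ is understood to be $1$ when $p=q$. *)

(* Defs.v *)
From mathcomp Require Import all_boot all_order all_algebra.
From mathcomp Require Import all_classical all_reals all_analysis.

Set Implicit Arguments.
Unset Strict Implicit.
Unset Printing Implicit Defensive.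

Import Order.TTheory GRing.Theory Num.Theory.
Import numFieldNormedType.Exports.

Local Open Scope classical_set_scope.
Local Open Scope ring_scope.

Definition closed_box (R : realType) (N : nat) (a b : 'rV[R]_N) : set 'rV[R]_N :=
  [set x | forall i, a ord0 i <= x ord0 i <= b ord0 i].

(* N-dimensional Lebesgue outer measure: infimum of the total volume of the
   countable covers by boxes. *)
Definition lebesgue_outer (R : realType) (N : nat) (A : set 'rV[R]_N) : \bar R :=
  ereal_inf [set s : \bar R | exists a b : nat -> 'rV[R]_N,
    [/\ forall k i, a k ord0 i <= b k ord0 i,
        A `<=` \bigcup_k closed_box (a k) (b k) &
        s = (\sum_(0 <= k <oo)
               (\prod_(i < N) (b k ord0 i - a k ord0 i))%:E)%E]].

(* The sigma-algebra on the codomain R is the Borel one, as usual for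
   real-valued measurable functions. *)
Definition lebesgue_measurable_fun (R : realType) (N : nat)
    (f : 'rV[R]_N -> R) : Prop :=
  forall B : set R, measurable B ->
    caratheodory_measurable (@lebesgue_outer R N) (f @^-1` B).

(* The real power [a `^ r] satisfies [0 `^ 0 = 1] and [0 `^ r = 0] for every
   r != 0, negative r included.  Hence [`|a| `^ (p - 2) * a] is 0 at a = 0 for
   every p, and [`|a| `^ (p - q)] is 1 for every a when p = q. *)

(* Main.v *)
(** By homogeneity in [u x - u y] and symmetry, for [u y < u x] the claim reads
    [v(x)^q / u(x)^(q-1) <= v(y)^q / u(y)^(q-1)
       + |v(x) - v(y)|^q / (u(x) - u(y))^(q-1)],
    which is the subadditivity of the perspective [(c, a) |-> c^q / a^(q-1)] of
    the convex function [c |-> c^q], since [v(x) <= v(y) + |v(x) - v(y)|]. *)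

Require Import Defs.
From mathcomp Require Import all_boot all_order all_algebra.
From mathcomp Require Import all_classical all_reals all_analysis.
From mathcomp Require Import ring.

Import Order.TTheory GRing.Theory Num.Theory.
Import numFieldNormedType.Exports.

Local Open Scope classical_set_scope.
Local Open Scope ring_scope.

(** Puts the quotient in the form [a * f (c / a)], to which convexity of [f] applies directly. *)
Lemma powR_perspective (R : realType) (q c a : R) : 0 <= c -> 0 < a ->
  c `^ q / a `^ (q - 1) = a * (c / a) `^ q.
Proof.
move=> c0 a0; rewrite powRM ?invr_ge0 ?(ltW a0)//.
have -> : a^-1 `^ q = (a `^ q)^-1.
  by rewrite -powRN -mulN1r powRrM powR_inv1// ltW.
by rewrite powRB ?(gt_eqF a0) ?implybT// powRr1 ?(ltW a0)// invf_div mulrCA.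
Qed.

(** Convexity of the [q]-th power at [d / b] and [e / t], with weights [b / (b + t)] and
    [t / (b + t)]: their weighted mean is [(d + e) / (b + t)]. Multiplying by [b + t] gives the
    claim. *)
Lemma powR_perspective_subadditive (R : realType) (q b t d e : R) :
  1 <= q -> 0 < b -> 0 < t -> 0 <= d -> 0 <= e ->
  (d + e) `^ q / (b + t) `^ (q - 1) <=
    d `^ q / b `^ (q - 1) + e `^ q / t `^ (q - 1).
Proof.
move=> q1 b0 t0 d0 e0; have bt0 : 0 < b + t by exact: addr_gt0.
rewrite !powR_perspective ?addr_ge0//.
have l0 : 0 <= b / (b + t) by rewrite divr_ge0 ?ltW.
have l1 : b / (b + t) <= 1 by rewrite ler_pdivrMr// mul1r lerDl ltW.
have : (b / (b + t) * (d / b) + (1 - b / (b + t)) * (e / t)) `^ q <=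
    b / (b + t) * (d / b) `^ q + (1 - b / (b + t)) * (e / t) `^ q.
  by apply: (convex_powR q1 (Itv01 l0 l1));
    rewrite inE/= in_itv/= andbT divr_ge0// ltW.
have -> : 1 - b / (b + t) = t / (b + t) by field; rewrite gt_eqF.
have -> : b / (b + t) * (d / b) + t / (b + t) * (e / t) = (d + e) / (b + t).
  by field; rewrite !gt_eqF.
rewrite -(ler_pM2l bt0); congr (_ <= _).
by field; rewrite gt_eqF.
Qed.

Lemma picone_powR_lt (R : realType) (p q a b c d : R) :
  1 < q -> 0 < b -> b < a -> 0 <= c -> 0 <= d ->
  `|a - b| `^ (p - 2) * (a - b) *
    (c `^ q / a `^ (q - 1) - d `^ q / b `^ (q - 1))
  <= `|c - d| `^ q * `|a - b| `^ (p - q).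
Proof.
move=> q1 b0 ba c0 d0.
have t0 : 0 < a - b by rewrite subr_gt0.
have a0 : 0 < a by exact: lt_trans ba.
rewrite gtr0_norm//; set t := a - b in t0 *.
have tpow (r s : R) : t `^ (r + s) = t `^ r * t `^ s.
  by rewrite powRD// (gt_eqF t0) implybT.
have -> : t `^ (p - 2) * t = t `^ (p - q) * t `^ (q - 1).
  by rewrite -{2}(powRr1 (ltW t0)) -!tpow; congr (_ `^ _); ring.
rewrite -mulrA mulrC [leRHS]mulrC [leLHS]mulrC ler_pM2l ?powR_gt0//.
rewrite mulrC -ler_pdivlMr ?powR_gt0// lerBlDl.
(* Here [e] is [|c - d|] and [b + t = a]; monotonicity in the numerator then replaces [d + |c - d|]
   by the smaller [c]. *)
have := powR_perspective_subadditive _ _ _ _ _ _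
  (ltW q1) b0 t0 d0 (normr_ge0 (c - d)).
rewrite /t addrCA subrr addr0; apply: le_trans.
rewrite ler_pM2r ?invr_gt0 ?powR_gt0//.
have cd : c <= d + `|c - d| by rewrite -lerBlDl ler_norm.
by rewrite ge0_ler_powR ?nnegrE ?addr_ge0// ltW// (lt_trans ltr01).
Qed.

Theorem proposition4p2 (R : realType) (N : nat) (p q : R)
    (hp : 1 < p) (hq : 1 < q) (hqp : q <= p)
    (u v : 'rV[R]_N -> R)
    (mu : lebesgue_measurable_fun u) (mv : lebesgue_measurable_fun v)
    (hv : forall x, 0 <= v x) (hu : forall x, 0 < u x) :
  forall x y : 'rV[R]_N,
    `|u x - u y| `^ (p - 2) * (u x - u y) *
      (v x `^ q / u x `^ (q - 1) - v y `^ q / u y `^ (q - 1))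
    <= `|v x - v y| `^ q * `|u x - u y| `^ (p - q).
Proof.
move=> x y; have [uyx|uxy|->] := ltgtP (u y) (u x).
- exact: picone_powR_lt.
(* Exchanging [x] and [y] changes the sign of both [u x - u y] and the bracket, so their product is
   unchanged. *)
- rewrite (distrC (v x)) (distrC (u x)) -(opprB (u y)).
  rewrite -[X in _ * X <= _]opprB !mulrN mulNr opprK.
  exact: picone_powR_lt.
- by rewrite subrr mulr0 mul0r mulr_ge0 ?powR_ge0.
Qed.
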